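(* Consider a pHDAE system of the semi-explicit index-1 form $$\begin{bmatrix} E_{11} & 0 \\ 0 & 0\end{bmatrix}\dot x = \begin{bmatrix} J_{11}-R_{11} & J_{12}-R_{12} \\ -J_{12}^T-R_{12}^T & J_{22}-R_{22}\end{bmatrix}x + \begin{bmatrix} B_1-P_1 \\ B_2-P_2\end{bmatrix}u,\qquad y = \begin{bmatrix} B_1^T+P_1^T & B_2^T+P_2^T\end{bmatrix}x + (S+N)u,$$ with $x(t)\in\mathbb R^n$, $u(t),y(t)\in\mathbb R^m$, where $E_{11}$ and $J_{22}-R_{22}$ are nonsingular. Write $E$, $A=J-R$, $\mathcal B=B-P$, $\mathcal C=(B+P)^T$, $D=S+N$ for its coefficient matrices and $H(s)=\mathcal C(sE-A)^{-1}\mathcal B+D$ for its transfer function. Let interpolation points $\sigma_1,\dots,\sigma_r\in\mathbb C$ and corresponding tangent directions $b_1,\dots,b_r\in\mathbb C^m$ be given, and let $$V=\begin{bmatrix} V_1 \\ V_2\end{bmatrix}=\left[(\sigma_1E-A)^{-1}\mathcal B b_1,\ \dots,\ (\sigma_rE-A)^{-1}\mathcal B b_r\right]\in\mathbb C^{n\times r},$$ partitioned conformably with the system. Then the reduced model $$\begin{bmatrix} V_1^TE_{11}V_1 & 0 \\ 0 & 0\end{bmatrix}\dot x_r = \begin{bmatrix} V_1^T(J_{11}-R_{11})V_1 & V_1^T(J_{12}-R_{12}) \\ (-J_{12}^T-R_{12}^T)V_1 & J_{22}-R_{22}\end{bmatrix}x_r + \begin{bmatrix} V_1^T(B_1-P_1)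 \\ B_2-P_2\end{bmatrix}u,$$ $$y_r = \begin{bmatrix} (B_1+P_1)^TV_1 & (B_2+P_2)^T\end{bmatrix}x_r + Du,$$ with transfer function denoted $\widehat H(s)$, retains the port-Hamiltonian structure (it is again a pHDAE system), tangentially interpolates the original model, i.e., $H(\sigma_i)b_i=\widehat H(\sigma_i)b_i$ for $i=1,\dots,r$, and matches the polynomial part of $H(s)$.
   Context: A linear time-invariant system $E\dot x=(J-R)x+(B-P)u$, $x(t_0)=0$, $y=(B+P)^Tx+(S+N)u$, with $E,J,R\in\mathbb R^{n\times n}$, $B,P\in\mathbb R^{n\times m}$, $S=S^T,\ N=-N^T\in\mathbb R^{m\times m}$, is called a port-Hamiltonian differential-algebraic (pHDAE) system if: (1) $J^T=-J$ and $E=E^T$; (2) $E$ is positive semidefinite; (3) the passivity matrix $W=\begin{bmatrix} R & P \\ P^T & S\end{bmatrix}$ is symmetric positive semidefinite. The transfer function of a system $E\dot x=Ax+\mathcal Bu$, $y=\mathcal Cx+Du$ is $\mathcal C(sE-A)^{-1}\mathcal B+D$. In the block form of the claim, the matrices $E,J,R,B,P$ are partitioned conformably: $E=\mathrm{diag}(E_{11},0)$, $J=\begin{bmatrix} J_{11} & J_{12} \\ -J_{12}^T & J_{22}\end{bmatrix}$, $R=\begin{bmatrix} R_{11} & R_{12} \\ R_{12}^T & R_{22}\end{bmatrix}$, $B=\begin{bmatrix} B_1 \\ B_2\end{bmatrix}$, $P=\begin{bmatrix} P_1 \\ P_2\end{bmatrix}$. The polynomial part of a rational matrix function is the polynomial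 matrix function in its decomposition as a strictly proper rational matrix function plus a polynomial matrix function. The superscript $T$ denotes the transpose.
   Formalization: The pHDAE claim is for real V_1, or after a change of basis V_1T if the (σ_i,b_i) are closed under conjugation; interpolation needs Ĥ(σ_i) defined; polynomial parts match if the reduced pencil is regular in these cases, otherwise if V_1^T E_11 V_1 is nonsingular. *)

(* Defs.v *)
From mathcomp Require Import all_boot all_order all_algebra.
From mathcomp Require Import reals.
From mathcomp Require Export complex.

Set Implicit Arguments.
Unset Strict Implicit.
Unset Printing Implicit Defensive.

Import Order.TTheory GRing.Theory Num.Theory.
Local Open Scope ring_scope.
Local Open Scope complex_scope.

(* E x' = A x + B u, y = C x + D u. *)
Record lti (F : Type) (n m : nat) := Lti {
  sysE : 'M[F]_n;
  sysA : 'M[F]_n;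
  sysB : 'M[F]_(n, m);
  sysC : 'M[F]_(m, n);
  sysD : 'M[F]_m }.

Definition toC (K : realType) (p q : nat) (M : 'M[K]_(p, q)) : 'M[K[i]]_(p, q) :=
  map_mx (real_complex K) M.

Definition lti_toC (K : realType) (n m : nat) (G : lti K n m) : lti K[i] n m :=
  Lti (toC (sysE G)) (toC (sysA G)) (toC (sysB G)) (toC (sysC G)) (toC (sysD G)).

Definition pencil (F : nzRingType) (n m : nat) (G : lti F n m) (s : F) : 'M[F]_n :=
  s *: sysE G - sysA G.

(* Meaningful only at the s where the pencil is invertible; elsewhere invmx
   returns its argument. *)
Definition transfer (F : comUnitRingType) (n m : nat) (G : lti F n m) (s : F) :
    'M[F]_m :=
  sysC G *m invmx (pencil G s) *m sysB G + sysD G.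

Definition regular (F : comUnitRingType) (n m : nat) (G : lti F n m) : Prop :=
  exists s, pencil G s \in unitmx.

Definition psd (K : realType) (n : nat) (M : 'M[K]_n) : Prop :=
  M^T = M /\ forall x : 'cV[K]_n, 0 <= (x^T *m M *m x) 0 0.

Definition phdae (K : realType) (n m : nat) (E J R : 'M[K]_n)
    (B P : 'M[K]_(n, m)) (S N : 'M[K]_m) : Prop :=
  [/\ S^T = S /\ N^T = - N,
      J^T = - J /\ E^T = E,
      psd E
    & psd (block_mx R P P^T S)].

Definition phdae_lti (K : realType) (n m : nat) (E J R : 'M[K]_n)
    (B P : 'M[K]_(n, m)) (S N : 'M[K]_m) : lti K n m :=
  Lti E (J - R) (B - P) (B + P)^T (S + N).

(* J, R, B, P, S, N are determined by G: J and - R are the skew-symmetric and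
   symmetric parts of sysA, N and S those of sysD, and B, P are the half-sum and
   half-difference of sysC^T and sysB.  In particular G has real coefficients. *)
Definition is_phdae (K : realType) (n m : nat) (G : lti K[i] n m) : Prop :=
  exists (E J R : 'M[K]_n) (B P : 'M[K]_(n, m)) (S N : 'M[K]_m),
    phdae E J R B P S N /\ G = lti_toC (phdae_lti E J R B P S N).

(* V1^T is the transpose without conjugation, also for complex V1. *)
Definition reduced_model (K : realType) (n1 n2 m r : nat)
    (E11 J11 R11 : 'M[K]_n1) (J12 R12 : 'M[K]_(n1, n2)) (J22 R22 : 'M[K]_n2)
    (B1 P1 : 'M[K]_(n1, m)) (B2 P2 : 'M[K]_(n2, m)) (D : 'M[K]_m)
    (V1 : 'M[K[i]]_(n1, r)) : lti K[i] (r + n2) m :=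
  Lti (block_mx (V1^T *m toC E11 *m V1) 0 0 0)
      (block_mx (V1^T *m toC (J11 - R11) *m V1) (V1^T *m toC (J12 - R12))
                (toC (- J12^T - R12^T) *m V1)   (toC (J22 - R22)))
      (col_mx (V1^T *m toC (B1 - P1)) (toC (B2 - P2)))
      (row_mx (toC (B1 + P1)^T *m V1) (toC (B2 + P2)^T))
      (toC D).

(* H = Q + num / den with num / den strictly proper.  A single denominator is
   used for all entries, and the identity is required off the roots of den, to
   which the finitely many exceptional points of H can always be added. Such a
   Q is unique, as the field is infinite. *)
Definition polynomial_part (F : fieldType) (m : nat) (H : F -> 'M[F]_m)
    (Q : 'M[{poly F}]_m) : Prop :=
  exists (num : 'M[{poly F}]_m) (den : {poly F}),
    [/\ den != 0,
        forall i j, (size (num i j) < size den)%N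
      & forall s, ~~ root den s ->
          H s = map_mx (fun p => p.[s]) Q
                + den.[s]^-1 *: map_mx (fun p => p.[s]) num].

Definition same_polynomial_part (F : fieldType) (m : nat)
    (H1 H2 : F -> 'M[F]_m) : Prop :=
  exists Q, polynomial_part H1 Q /\ polynomial_part H2 Q.

Definition conj_closed (K : realType) (m r : nat) (sigma : 'I_r -> K[i])
    (b : 'I_r -> 'cV[K[i]]_m) : Prop :=
  forall i, exists j, sigma j = (sigma i)^* /\ b j = map_mx (@conjc K) (b i).

(* Main.v *)
Require Import Defs.
From mathcomp Require Import all_boot all_order all_algebra.
From mathcomp Require Import reals.
From mathcomp Require Import ring.

Set Implicit Arguments.
Unset Strict Implicit.
Unset Printing Implicit Defensive.

Import Order.TTheory GRing.Theory Num.Theory.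
Local Open Scope ring_scope.
Local Open Scope complex_scope.

(** With [T = diag (V1, I)] the reduced model is the Galerkin projection
    [(T^T E T, T^T A T, T^T B, C T, D)] of the original one.  A real [T] acts by
    congruence, so the pH structure survives; [(sigma_i E - A)^-1 B b_i] lies in
    the range of [T], which gives interpolation; and eliminating the algebraic
    variables shows that the polynomial part is the constant
    [D - C2 A22^-1 B2], on which the projection does not act.  If the data are
    closed under conjugation, the column space of [V1] has a real basis, so [V1]
    may be made real by an invertible change of reduced coordinates.  For a real
    [V1], definiteness of [E11] turns regularity of the reduced pencil into
    invertibility of [V1^T E11 V1]. *)

(** * Galerkin projection of state-space systems *)

Definition galerkin (F : nzRingType) (n k m : nat) (T : 'M[F]_(n, k))
    (G : lti F n m) : lti F k m :=
  Lti (T^T *m sysE G *m T) (T^T *m sysA G *m T) (T^T *m sysB G)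
      (sysC G *m T) (sysD G).

Lemma pencil_galerkin (F : comNzRingType) (n k m : nat) (T : 'M[F]_(n, k))
    (G : lti F n m) (s : F) :
  pencil (galerkin T G) s = T^T *m pencil G s *m T.
Proof. by rewrite /pencil /= mulmxBr mulmxBl -scalemxAr -scalemxAl. Qed.

(** An invertible [T] changes the state coordinates and [T^T] recombines the state equations; both
    cancel in [C P^-1 B], where [P] is the pencil. *)
Lemma transfer_galerkin_unit (F : comUnitRingType) (n m : nat) (T : 'M[F]_n)
    (G : lti F n m) (s : F) :
  T \in unitmx -> pencil G s \in unitmx ->
  pencil (galerkin T G) s \in unitmx /\
  transfer (galerkin T G) s = transfer G s.
Proof.
move=> uT uG; have uTT : T^T \in unitmx by rewrite unitmx_tr.
have uP : T^T *m pencil G s *m T \in unitmx by rewrite !unitmx_mul uTT uG uT.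
rewrite /transfer pencil_galerkin /=; split=> //.
congr (_ + _); suff -> : invmx (T^T *m pencil G s *m T) =
    invmx T *m invmx (pencil G s) *m invmx T^T.
  by rewrite !mulmxA mulmxK // mulmxKV.
apply: (can_inj (mulKmx uP)).
by rewrite mulmxV // !mulmxA mulmxK // mulmxK // mulmxV.
Qed.

(** Applying [T^T] to the full equation at the state [T z] gives the projected equation for [z]. Its
    solution is unique, so the reduced state is [z] and both outputs agree. *)
Lemma galerkin_interpolation (F : comUnitRingType) (n k m : nat)
    (T : 'M[F]_(n, k)) (G : lti F n m) (s : F) (v : 'cV[F]_m) (z : 'cV[F]_k) :
  pencil G s \in unitmx -> pencil (galerkin T G) s \in unitmx ->
  invmx (pencil G s) *m sysB G *m v = T *m z ->
  transfer G s *m v = transfer (galerkin T G) s *m v.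
Proof.
move=> uG uT xE; rewrite /transfer !mulmxDl /=; congr (_ + _).
have zE : invmx (pencil (galerkin T G) s) *m (T^T *m sysB G *m v) = z.
  apply: (can_inj (mulKmx uT)).
  rewrite mulKVmx // pencil_galerkin -[RHS]mulmxA -xE.
  by rewrite !mulmxA mulmxK.
by rewrite -!mulmxA [T^T *m (_ *m _)]mulmxA zE -xE !mulmxA.
Qed.

Lemma lti_toC_galerkin (K : realType) (n k m : nat) (T : 'M[K]_(n, k))
    (G : lti K n m) :
  lti_toC (galerkin T G) = galerkin (toC T) (lti_toC G).
Proof. by rewrite /lti_toC /galerkin /toC /= !map_mxM map_trmx. Qed.

(** * Congruence, semidefiniteness and port-Hamiltonian structure *)

Lemma psd_congr (K : realType) (n k : nat) (M : 'M[K]_n) (T : 'M[K]_(n, k)) :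
  psd M -> psd (T^T *m M *m T).
Proof.
move=> [sM pM]; split; first by rewrite !trmx_mul trmxK sM mulmxA.
by move=> x; have := pM (T *m x); rewrite trmx_mul !mulmxA.
Qed.

Lemma galerkin_phdae_lti (K : realType) (n k m : nat) (E J R : 'M[K]_n)
    (B P : 'M[K]_(n, m)) (S N : 'M[K]_m) (T : 'M[K]_(n, k)) :
  galerkin T (phdae_lti E J R B P S N) =
  phdae_lti (T^T *m E *m T) (T^T *m J *m T) (T^T *m R *m T)
            (T^T *m B) (T^T *m P) S N.
Proof.
rewrite /galerkin /phdae_lti /= mulmxBr mulmxBl mulmxBr -mulmxDr.
by rewrite trmx_mul trmxK.
Qed.

Lemma phdae_galerkin (K : realType) (n k m : nat) (E J R : 'M[K]_n)
    (B P : 'M[K]_(n, m)) (S N : 'M[K]_m) (T : 'M[K]_(n, k)) :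
  phdae E J R B P S N ->
  phdae (T^T *m E *m T) (T^T *m J *m T) (T^T *m R *m T)
        (T^T *m B) (T^T *m P) S N.
Proof.
move=> [SN [sJ sE] pE pW]; split=> //.
- by rewrite !trmx_mul trmxK sJ sE !mulmxA mulmxN mulNmx.
- exact: psd_congr.
(* The passivity matrix undergoes a congruence by [diag (T, I)]; the identity block leaves the port
   variables, hence [S], untouched. *)
have := psd_congr (block_mx T 0 0 1%:M) pW.
rewrite tr_block_mx !trmx0 trmx1 !mulmx_block !(mulmx0, mul0mx, addr0, add0r).
by rewrite !mul1mx !mulmx1 trmx_mul trmxK.
Qed.

Lemma is_phdae_galerkin (K : realType) (n k m : nat) (T : 'M[K]_(n, k))
    (G : lti K[i] n m) :
  is_phdae G -> is_phdae (galerkin (toC T) G).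
Proof.
move=> [E [J [R [B [P [S [N [phG ->]]]]]]]].
rewrite -lti_toC_galerkin galerkin_phdae_lti.
do 7!eexists; split; last reflexivity.
exact: phdae_galerkin.
Qed.

Lemma reduced_modelE (K : realType) (n1 n2 m r : nat)
    (E11 J11 R11 : 'M[K]_n1) (J12 R12 : 'M[K]_(n1, n2)) (J22 R22 : 'M[K]_n2)
    (B1 P1 : 'M[K]_(n1, m)) (B2 P2 : 'M[K]_(n2, m)) (S N : 'M[K]_m)
    (V1 : 'M[K[i]]_(n1, r)) :
  reduced_model E11 J11 R11 J12 R12 J22 R22 B1 P1 B2 P2 (S + N) V1 =
  galerkin (block_mx V1 0 0 1%:M)
    (lti_toC (phdae_lti (block_mx E11 0 0 0) (block_mx J11 J12 (- J12^T) J22)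
       (block_mx R11 R12 R12^T R22) (col_mx B1 B2) (col_mx P1 P2) S N)).
Proof.
rewrite /reduced_model /galerkin /lti_toC /toC /=.
rewrite tr_block_mx !trmx0 trmx1 opp_block_mx add_block_mx opp_col_mx.
rewrite !add_col_mx tr_col_mx !map_block_mx map_row_mx !map_col_mx !map_mx0.
rewrite !mulmx_block mul_block_col mul_row_block.
by rewrite !(mulmx0, mul0mx, addr0, add0r, mul1mx, mulmx1).
Qed.

(** With [y = M x], the form at [x + t y] is [2 t |y|^2 + t^2 y^T M y]. It is nonnegative for every
    [t], which forces the linear coefficient [|y|^2] to vanish. *)
Lemma psd_quad_eq0 (K : realType) (n : nat) (M : 'M[K]_n) (x : 'cV[K]_n) :
  psd M -> (x^T *m M *m x) 0 0 = 0 -> M *m x = 0.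
Proof.
move=> [sM pM] x0; set y := M *m x.
set a := (y^T *m y) 0 0; set c := (y^T *m M *m y) 0 0.
have c0 : 0 <= c := pM y.
have aE : a = \sum_i y i 0 ^+ 2.
  by rewrite /a mxE; apply: eq_bigr => i _; rewrite mxE expr2.
have a0 : 0 <= a by rewrite aE sumr_ge0 // => i _; exact: sqr_ge0.
have quad t : 0 <= 2 * t * a + t ^+ 2 * c.
  have := pM (x + t *: y).
  have -> : (x + t *: y)^T *m M *m (x + t *: y) =
      x^T *m M *m x + t *: (y^T *m y + y^T *m y) + t ^+ 2 *: (y^T *m M *m y).
    have -> : (x + t *: y)^T = x^T + t *: y^T.
      by apply/matrixP => i j; rewrite !mxE.
    rewrite !mulmxDl !mulmxDr -!scalemxAl -!scalemxAr.
    rewrite -!mulmxA -/y.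
    have -> : x^T *m (M *m y) = y^T *m y by rewrite /y trmx_mul sM !mulmxA.
    by rewrite scalerA -expr2 scalerDr !addrA.
  have entE (A1 A2 A3 : 'M[K]_1) :
      (A1 + t *: (A2 + A2) + t ^+ 2 *: A3) 0 0 =
      A1 0 0 + t * (A2 0 0 + A2 0 0) + t ^+ 2 * A3 0 0 by rewrite !mxE.
  rewrite entE x0 add0r -/a -/c; congr (0 <= _ + _); ring.
have {quad} aa0 : a = 0.
  have c1 : 0 < c + 1 by rewrite ltr_wpDl.
  apply/eqP; rewrite -sqrf_eq0 eq_le sqr_ge0 andbT.
  (* The minimiser [- a / c] is shifted to [- a / (c + 1)], since [c] may be zero. *)
  have := quad (- a / (c + 1)).
  rewrite -(pmulr_rge0 _ (exprn_gt0 2 c1)).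
  have -> : (c + 1) ^+ 2 * (2 * (- a / (c + 1)) * a + (- a / (c + 1)) ^+ 2 * c)
     = - (a ^+ 2 * (c + 2)).
    by field; rewrite gt_eqF.
  by rewrite oppr_ge0 pmulr_lle0 // ltr_wpDl.
apply/matrixP => i j; rewrite ord1 [RHS]mxE; apply/eqP; rewrite -sqrf_eq0 -/y.
have /eqP := aa0; rewrite aE psumr_eq0; last by move=> k _; exact: sqr_ge0.
by move/allP/(_ i); apply; rewrite mem_index_enum.
Qed.

(** * Degree bounds and the polynomial part at index 1 *)

Lemma size_det_linear (F : comNzRingType) (n : nat) (A : 'M[{poly F}]_n) :
  (forall i j, (size (A i j) <= 2)%N) -> (size (\det A) <= n.+1)%N.
Proof.
move=> szA; apply: (leq_trans (size_sum _ _ _)); apply/bigmax_leqP => s _.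
rewrite size_Msign; apply: (leq_trans (size_poly_prod_leq _ _)).
rewrite leq_subLR card_ord addnS ltnS addnn -mul2n mulnC.
apply: (@leq_trans (\sum_(i < n) 2)); first exact: leq_sum.
by rewrite sum_nat_const card_ord.
Qed.

(** Cofactors are determinants of order [n.-1] with entries of degree at most one. As [char_poly A]
    has size [n.+1], the quotient of the adjugate by it is strictly proper. *)
Lemma size_adj_char_poly_mx (F : comNzRingType) (n : nat) (A : 'M[F]_n) i j :
  (size (\adj (char_poly_mx A) i j) <= n)%N.
Proof.
rewrite mxE size_Msign.
have n_gt0 : (0 < n)%N by case: (n) i => [[]|].
rewrite -[leqRHS](prednK n_gt0); apply: size_det_linear => k l; rewrite !mxE.
apply: (leq_trans (size_polyD _ _)); rewrite size_polyN geq_max.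
rewrite (leq_trans (size_polyC_leq1 _)) // andbT.
by case: (_ == _); rewrite ?mulr1n ?mulr0n ?size_polyX // size_poly0.
Qed.

Lemma size_mx_const_mul (F : idomainType) (p n q d : nat) (X : 'M[F]_(p, n))
    (A : 'M[{poly F}]_n) (Y : 'M[F]_(n, q)) i j :
  (forall k l, (size (A k l) <= d)%N) ->
  (size ((map_mx polyC X *m A *m map_mx polyC Y) i j) <= d)%N.
Proof.
move=> szA; rewrite mxE; apply: (leq_trans (size_sum _ _ _)).
apply/bigmax_leqP => l _; rewrite mxE [_ * _]mulrC mxE mul_polyC.
apply: (leq_trans (size_scale_leq _ _)).
apply: (leq_trans (size_sum _ _ _)); apply/bigmax_leqP => k _.
by rewrite mxE mul_polyC; apply: (leq_trans (size_scale_leq _ _)).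
Qed.

(* Eliminating the algebraic variables leaves an ordinary state-space system
   with pencil [s E11 - (A11 - A12 A22^-1 A21)], whose transfer function is
   strictly proper. *)
Lemma polynomial_part_index1 (F : fieldType) (n1 n2 m : nat)
    (E11 A11 : 'M[F]_n1) (A12 : 'M[F]_(n1, n2)) (A21 : 'M[F]_(n2, n1))
    (A22 : 'M[F]_n2) (B1 : 'M[F]_(n1, m)) (B2 : 'M[F]_(n2, m))
    (C1 : 'M[F]_(m, n1)) (C2 : 'M[F]_(m, n2)) (D : 'M[F]_m) :
  E11 \in unitmx -> A22 \in unitmx ->
  polynomial_part
    (transfer (Lti (block_mx E11 0 0 0) (block_mx A11 A12 A21 A22)
                   (col_mx B1 B2) (row_mx C1 C2) D))
    (map_mx polyC (D - C2 *m invmx A22 *m B2)).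
Proof.
move=> uE uA; set G := Lti _ _ _ _ _.
(* [As] is the Schur complement of [A22]. Since [X] evaluates to [s - E11^-1 As], the eliminated
   pencil [s E11 - As] is [E11] times that value. *)
pose As := A11 - A12 *m invmx A22 *m A21.
pose M := invmx E11 *m As; pose X := char_poly_mx M.
pose hor s p q (Z : 'M[{poly F}]_(p, q)) := map_mx (fun f => f.[s]) Z.
have horE s p q (Z : 'M[{poly F}]_(p, q)) : hor s p q Z = map_mx (horner_eval s) Z.
  by apply/matrixP => i j; rewrite !mxE.
(* The inverse of [s E11 - As], written by Cramer's rule so that numerator and denominator are
   polynomials in [s]. *)
pose Rs s := (char_poly M).[s]^-1 *: hor s _ _ (\adj X) *m invmx E11.
have RsK s : ~~ root (char_poly M) s -> (s *: E11 - As) *m Rs s = 1%:M.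
  move=> den0.
  have -> : s *: E11 - As = E11 *m hor s _ _ X.
    rewrite horE map_mxB /= map_scalar_mx /= /horner_eval hornerX mulmxBr.
    rewrite mul_mx_scalar -map_mx_comp; congr (_ - _).
    rewrite -[LHS](mulKVmx uE); congr (_ *m _).
    by apply/matrixP => i j; rewrite [RHS]mxE /= hornerC.
  rewrite /Rs -mulmxA [hor s _ _ X *m _]mulmxA -scalemxAr !horE -map_mxM.
  rewrite mul_mx_adj map_scalar_mx /= -scalemxAl mul_scalar_mx scalerA.
  by rewrite /horner_eval mulVf // scale1r mulmxV.
(* Block elimination for the right-hand side [(Y1, Y2)]: the second block row gives [X2] in terms of
   [X1], and substitution leaves an equation for [X1] alone. *)
pose X1 s q (Y1 : 'M[F]_(n1, q)) Y2 := Rs s *m (Y1 - A12 *m invmx A22 *m Y2).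
pose X2 s q (Y1 : 'M[F]_(n1, q)) Y2 :=
  - (invmx A22 *m (A21 *m X1 s q Y1 Y2 + Y2)).
have solve s q Y1 Y2 : ~~ root (char_poly M) s ->
    pencil G s *m col_mx (X1 s q Y1 Y2) (X2 s q Y1 Y2) = col_mx Y1 Y2.
  move=> den0; rewrite /pencil /= scale_block_mx !scaler0 opp_block_mx.
  rewrite add_block_mx !add0r mul_block_col; congr col_mx.
    have -> : s *: E11 - A11 = (s *: E11 - As) - A12 *m invmx A22 *m A21.
      by rewrite /As opprB addrA addrAC addrK.
    rewrite mulmxBl {1}/X1 mulmxA RsK // mul1mx mulmxN mulNmx opprK.
    by rewrite !mulmxDr !mulmxA addrA !subrK.
  by rewrite mulNmx mulmxN mulNmx opprK mulKVmx // addrA addNr add0r.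
have unitP s : ~~ root (char_poly M) s -> pencil G s \in unitmx.
  (* The identity as right-hand side yields a right inverse of the pencil. *)
  move=> den0; have := solve s _ (row_mx 1%:M 0) (row_mx 0 1%:M) den0.
  by rewrite -[col_mx (row_mx _ _) _]/(block_mx _ _ _ _) -scalar_mx_block => /mulmx1_unit[].
(* Output and input matrices of the eliminated system; [Bt] also absorbs the factor [E11^-1] of
   [Rs]. *)
pose Ct := C1 - C2 *m invmx A22 *m A21.
pose Bt := invmx E11 *m (B1 - A12 *m invmx A22 *m B2).
exists (map_mx polyC Ct *m \adj X *m map_mx polyC Bt), (char_poly M).
split; first by rewrite monic_neq0 // char_poly_monic.
  move=> i j; rewrite size_char_poly ltnS; apply: size_mx_const_mul => k l.
  exact: size_adj_char_poly_mx.
move=> s den0; rewrite /transfer /= -(solve s _ B1 B2 den0).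
rewrite -mulmxA mulKmx ?unitP // mul_row_col.
have polyCE p q (Z : 'M[F]_(p, q)) : hor s p q (map_mx polyC Z) = Z.
  by apply/matrixP => i j; rewrite !mxE hornerC.
rewrite -[map_mx _ (map_mx _ _)]/(hor _ _ _ _) polyCE.
rewrite -[map_mx _ (_ *m _)]/(hor _ _ _ _) horE !map_mxM -!horE !polyCE.
have -> : (char_poly M).[s]^-1 *: (Ct *m hor s _ _ (\adj X) *m Bt) =
    Ct *m X1 s _ B1 B2.
  by rewrite /X1 /Rs /Bt -!mulmxA -!scalemxAl -!scalemxAr !mulmxA.
rewrite /X2; move: (X1 s m B1 B2) => x; rewrite mulmxN mulmxDr mulmxDr !mulmxA /Ct mulmxBl.
by rewrite opprD addrA [RHS]addrC [LHS]addrAC [RHS]addrA.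
Qed.

(** * Real coordinates and regularity of the reduced pencil *)

Lemma galerkin_comp (F : comNzRingType) (n k l m : nat) (T : 'M[F]_(n, k))
    (U : 'M[F]_(k, l)) (G : lti F n m) :
  galerkin (T *m U) G = galerkin U (galerkin T G).
Proof. by rewrite /galerkin /= !trmx_mul !mulmxA. Qed.

(** A space closed under conjugation contains the real and imaginary parts of its vectors, and these
    span it; hence it has a real basis. The proof works with the row space of [V^T]. *)
Lemma conj_invariant_real_basis (K : realType) (p r : nat) (V : 'M[K[i]]_(p, r)) :
  (forall i, exists j, col j V = map_mx (@conjc K) (col i V)) ->
  exists T W, T \in unitmx /\ V *m T = toC W.
Proof.
move=> conjV; set A := V^T.
have conjA : (map_mx (@conjc K) A <= A)%MS.
  apply/row_subP => i; have [j Vj] := conjV i.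
  suff -> : row i (map_mx (@conjc K) A) = row j A by exact: row_sub.
  apply/rowP => k; have /colP/(_ k) := Vj; rewrite !mxE => ->.
  by [].
pose Ar := map_mx (@complex.Re K) A; pose Ai := map_mx (@complex.Im K) A.
have AE : A = toC Ar + 'i%C *: toC Ai.
  by apply/matrixP => i j; rewrite !mxE -complexE.
have ArE : toC Ar = 2^-1 *: (A + map_mx (@conjc K) A).
  by apply/matrixP => i j; rewrite !mxE [LHS]ReJ_add mulrC.
have AiE : toC Ai = ('i%C / 2) *: (map_mx (@conjc K) A - A).
  by apply/matrixP => i j; rewrite !mxE [LHS]ImJ_sub; ring.
pose M := col_mx Ar Ai.
have eqM : (toC M :=: A)%MS.
  apply/eqmxP; rewrite /toC map_col_mx -addsmxE addsmx_sub; apply/andP; split.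
    apply/andP; split; rewrite -/(toC _) ?ArE ?AiE scalemx_sub // addmx_sub //.
    by rewrite eqmx_opp.
  by rewrite [X in (X <= _)%MS]AE -addsmxE addmx_sub_adds // scalemx_sub.
have rkM : (\rank M <= r)%N by rewrite -(mxrank_map (real_complex K)) eqM rank_leq_row.
(* [pid_mx] pads the real basis with zero rows up to [r], so that [toC W] and [A] have equal shape
   and differ by an invertible factor. *)
pose W := (pid_mx (\rank M) : 'M[K]_(r, \rank M)) *m row_base M.
have eqW : (W :=: M)%MS.
  apply: eqmx_trans (eq_row_base M); apply: eqmxMfull.
  by rewrite /row_full rank_pid_mx.
have /eqmxMunitP[T uT WE] : (toC W == A)%MS.
  have : (toC W :=: toC M)%MS by exact/map_eqmx.
  by move=> /eqmx_trans/(_ eqM)/eqmxP.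
exists T^T, W^T; rewrite unitmx_tr; split=> //.
by rewrite /toC -map_trmx -/(toC W) WE trmx_mul trmxK.
Qed.

(** If [y] is in the kernel of [W^T E11 W], semidefiniteness gives [E11 W y^T = 0], so [W y^T = 0].
    Then the projected pencil kills [(y^T, 0)] at every [s], and regularity gives [y = 0]. *)
Lemma regular_galerkin_unit (K : realType) (n1 n2 m r : nat) (E11 : 'M[K]_n1)
    (W : 'M[K]_(n1, r)) (G : lti K[i] (n1 + n2) m) :
  psd E11 -> E11 \in unitmx ->
  regular (galerkin (block_mx (toC W) 0 0 1%:M) G) ->
  W^T *m E11 *m W \in unitmx.
Proof.
move=> pE uE [s]; rewrite pencil_galerkin => uP.
rewrite -row_free_unit -kermx_eq0; apply/eqP/row_matrixP => i; rewrite row0.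
set y := row i _; have yK : y *m (W^T *m E11 *m W) = 0.
  by apply/sub_kermxP; exact: row_sub.
have EWy : E11 *m (W *m y^T) = 0.
  apply: psd_quad_eq0 => //; rewrite trmx_mul trmxK.
  have -> : y *m W^T *m E11 *m (W *m y^T) = y *m (W^T *m E11 *m W) *m y^T.
    by rewrite !mulmxA.
  by rewrite yK mul0mx mxE.
have Wy : W *m y^T = 0 by rewrite -[LHS](mulKmx uE) EWy mulmx0.
have z0 : col_mx (toC y^T) (0 : 'cV_n2) = 0.
  apply: (can_inj (mulKmx uP)); rewrite mulmx0 -[LHS]mulmxA mul_block_col.
  by rewrite !(mulmx0, mul0mx, addr0) -map_mxM Wy map_mx0 col_mx0 mulmx0.
have := congr1 usubmx z0; rewrite col_mxKu linear0 => /eqP.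
by rewrite map_mx_eq0 => /eqP y0; rewrite -[y]trmxK y0 trmx0.
Qed.

Lemma psd_ulsubmx (K : realType) (n1 n2 : nat) (M : 'M[K]_(n1 + n2)) :
  psd M -> psd (ulsubmx M).
Proof.
move=> /(psd_congr (col_mx 1%:M 0)); rewrite -{1}[M]submxK tr_col_mx trmx0.
by rewrite trmx1 mul_row_block mul_row_col !(mul1mx, mul0mx, mulmx0, mulmx1, addr0).
Qed.

(** A complex [V1] may yield complex reduced coefficients, whereas the port-Hamiltonian structure is
    a property of real ones. Hence the two cases of a real [V1] and of conjugation-closed data, the
    latter up to a change of coordinates [T]. *)
Theorem theorem2 (K : realType) (n1 n2 m r : nat)
  (E11 J11 R11 : 'M[K]_n1) (J12 R12 : 'M[K]_(n1, n2)) (J22 R22 : 'M[K]_n2)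
  (B1 P1 : 'M[K]_(n1, m)) (B2 P2 : 'M[K]_(n2, m)) (S N : 'M[K]_m)
  (sigma : 'I_r -> K[i]) (b : 'I_r -> 'cV[K[i]]_m) :
  let E := block_mx E11 0 0 0 : 'M[K]_(n1 + n2) in
  let J := block_mx J11 J12 (- J12^T) J22 in
  let R := block_mx R11 R12 R12^T R22 in
  let B := col_mx B1 B2 in
  let P := col_mx P1 P2 in
  let G := lti_toC (phdae_lti E J R B P S N) in
  let V : 'M[K[i]]_(n1 + n2, r) :=
    \matrix_(k, i) (invmx (pencil G (sigma i)) *m sysB G *m b i) k 0 in
  let V1 := usubmx V in
  let red (W : 'M[K[i]]_(n1, r)) :=
    reduced_model E11 J11 R11 J12 R12 J22 R22 B1 P1 B2 P2 (S + N) W in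
  let Gr := red V1 in
  let V1_real := exists W : 'M[K]_(n1, r), V1 = toC W in
  phdae E J R B P S N ->
  E11 \in unitmx ->
  J22 - R22 \in unitmx ->
  (forall i, pencil G (sigma i) \in unitmx) ->
  [/\ V1_real -> is_phdae Gr,
      conj_closed sigma b ->
        exists T : 'M[K[i]]_r,
          [/\ T \in unitmx,
              is_phdae (red (V1 *m T))
            & forall s, pencil Gr s \in unitmx ->
                pencil (red (V1 *m T)) s \in unitmx /\
                transfer (red (V1 *m T)) s = transfer Gr s],
      forall i, pencil Gr (sigma i) \in unitmx ->
        transfer G (sigma i) *m b i = transfer Gr (sigma i) *m b i,
      V1_real \/ conj_closed sigma b -> regular Gr ->
        same_polynomial_part (transfer G) (transfer Gr)
    & V1^T *m toC E11 *m V1 \in unitmx ->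
        same_polynomial_part (transfer G) (transfer Gr)].

Proof.
move=> E J R B P G V V1 red Gr V1_real phG uE11 uA22 uG.
pose That p q (W : 'M[K[i]]_(p, q)) : 'M_(p + n2, q + n2) := block_mx W 0 0 1%:M.
have redE W : red W = galerkin (That _ _ W) G by exact: reduced_modelE.
have redM W T : red (W *m T) = galerkin (That _ _ T) (red W).
  rewrite !redE -galerkin_comp; congr galerkin.
  by rewrite /That mulmx_block !(mulmx0, mul0mx, addr0, add0r, mulmx1).
have redP W : is_phdae (red (toC W)).
  rewrite redE; have -> : That _ _ (toC W) = toC (block_mx W 0 0 1%:M).
    by rewrite /toC map_block_mx !map_mx0 map_mx1.
  by apply: is_phdae_galerkin; exists E, J, R, B, P, S, N.
have pE : psd E11.
  by case: phG => _ _ /psd_ulsubmx; rewrite block_mxKul.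
have colV i : col i V = invmx (pencil G (sigma i)) *m sysB G *m b i.
  by apply/colP => k; rewrite !mxE.
have real_basis : conj_closed sigma b -> exists T W, T \in unitmx /\ V1 *m T = toC W.
  move=> cc; apply: conj_invariant_real_basis => i.
  have [j [sj bj]] := cc i; exists j.
  have colV1 k : col k V1 = usubmx (col k V) by apply/matrixP => l h; rewrite !mxE.
  have conj_toC p q (M : 'M[K]_(p, q)) : map_mx (@conjc K) (toC M) = toC M.
    by apply/matrixP => k l; rewrite !mxE conjc_real.
  (* The coefficients of [G] are real, so conjugating column [i] of [V] gives the column for the
     conjugate point and direction. *)
  have pencilJ s : map_mx (@conjc K) (pencil G s) = pencil G (s^*).
    by rewrite /pencil map_mxB map_mxZ !conj_toC.
  by rewrite !colV1 map_usubmx !colV sj bj !map_mxM map_invmx pencilJ conj_toC.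
have red_unit T : T \in unitmx -> forall s, pencil Gr s \in unitmx ->
    pencil (red (V1 *m T)) s \in unitmx /\
    transfer (red (V1 *m T)) s = transfer Gr s.
  move=> uT s uP; rewrite redM; apply: transfer_galerkin_unit => //.
  by rewrite unitmxE det_ublock det1 mulr1 -unitmxE.
have same_poly : V1^T *m toC E11 *m V1 \in unitmx ->
    same_polynomial_part (transfer G) (transfer Gr).
  move=> uEr.
  have poly q (W : 'M[K[i]]_(n1, q)) : W^T *m toC E11 *m W \in unitmx ->
      polynomial_part (transfer (reduced_model E11 J11 R11 J12 R12 J22 R22
        B1 P1 B2 P2 (S + N) W))
        (map_mx polyC (toC (S + N) -
          toC (B2 + P2)^T *m invmx (toC (J22 - R22)) *m toC (B2 - P2))).
    by move=> uW; apply: polynomial_part_index1; rewrite // map_unitmx.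
  (* [G] is itself the projection along [V1 = 1], so one formula covers both. *)
  have GE : G = reduced_model E11 J11 R11 J12 R12 J22 R22 B1 P1 B2 P2 (S + N) 1%:M.
    rewrite reduced_modelE -scalar_mx_block /galerkin trmx1 !mul1mx !mulmx1.
    by [].
  eexists; split; last exact: poly uEr.
  by rewrite GE; apply: poly; rewrite trmx1 mul1mx mulmx1 map_unitmx.
split; last exact: same_poly.
- by move=> [W VW]; rewrite /Gr VW; exact: redP.
- move=> /real_basis[T [W [uT VT]]]; exists T.
  by split; [exact: uT | rewrite VT; exact: redP | exact: red_unit].
(* [z] selects column [i] of [V1] and copies the algebraic part of column [i] of [V], so the full
   solution lies in the range of the projection. *)
- move=> i uP; pose z := col_mx (delta_mx i 0) (dsubmx (col i V)).
  have zE : That _ _ V1 *m z = col i V.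
    rewrite mul_block_col !mul0mx addr0 add0r mul1mx -colE -[RHS]vsubmxK.
    by congr col_mx; apply/matrixP => k l; rewrite !mxE.
  rewrite /Gr redE in uP *; apply: galerkin_interpolation uP _ => //.
  by rewrite -colV -zE.
move=> V1cases regGr; apply: same_poly.
have [T [W [uT VT]]] : exists T W, T \in unitmx /\ V1 *m T = toC W.
  by case: V1cases => [[W VW]|/real_basis //]; exists 1%:M, W; rewrite unitmx1 mulmx1.
have : W^T *m E11 *m W \in unitmx.
  apply: (@regular_galerkin_unit _ _ n2 m _ _ _ G pE uE11).
  have [s uP] := regGr; exists s.
  by have [+ _] := red_unit _ uT _ uP; rewrite VT redE.
(* Over the complex field the matrix is [T^T (V1^T E11 V1) T]; the outer factors are stripped
   off. *)
rewrite -(map_unitmx (real_complex K)) !map_mxM -map_trmx.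
rewrite -!/(toC _) -VT trmx_mul -!mulmxA unitmx_mul => /andP[_].
by rewrite !mulmxA unitmx_mul => /andP[].
Qed.
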